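(* Let $d\ge 2$ be an integer, let $0<\varepsilon<1/2$, and let $c$ be a constant (independent of $n$) with $$c \;\ge\; \frac{10^6\, d^3 \,\log d\, \log^2 (2/\varepsilon)}{\varepsilon}.$$ Then almost surely the random graph $G(n,c/n)$ contains (simultaneously) a copy of every tree of maximum degree at most $d$ on $\lfloor(1-\varepsilon)n\rfloor$ vertices. That is, the probability that $G(n,c/n)$ contains, for every tree $T$ on $\lfloor(1-\varepsilon)n\rfloor$ vertices with maximum degree at most $d$, a (not necessarily induced) subgraph isomorphic to $T$ tends to $1$ as $n\to\infty$.
   Context: $G(n,p)$ denotes the random graph on a fixed set of $n$ vertices in which each pair of vertices forms an edge, randomly and independently, with probability $p$. A graph property holds almost surely if the probability that $G(n,p)$ satisfies it tends to $1$ as $n\to\infty$. $\log$ is the natural logarithm. *)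

(* Defs.v *)
From HB Require Import structures.
From mathcomp Require Import all_boot all_order all_algebra.
From mathcomp Require Import all_classical all_reals all_analysis.

Set Implicit Arguments.
Unset Strict Implicit.
Unset Printing Implicit Defensive.

Import Order.TTheory GRing.Theory Num.Theory.
Import numFieldNormedType.Exports.

Local Open Scope ring_scope.
Local Open Scope classical_set_scope.

Section Graphs.
Variable V : finType.

Record sgraph := SGraph {
  edges : {set {set V}};
  edges_card2 : [forall e in edges, #|e| == 2%N] }.

HB.instance Definition _ := [isSub for edges].
HB.instance Definition _ := [Finite of sgraph by <:].

Implicit Type G : sgraph.

(* Irreflexive because [set x; x] has cardinal 1. *)
Definition adj G : rel V := fun x y => [set x; y]%SET \in edges G.

Definition degree G (x : V) : nat := #|[set y | adj G x y]%SET|.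

Definition max_degree_le G (d : nat) : Prop := forall x, (degree G x <= d)%N.

Definition connected_graph G : Prop :=
  (0 < #|V|)%N /\ forall x y, connect (adj G) x y.

(* [ucycle] also accepts the empty sequence and the closed walks x, y, x
   along a single edge, which are not graph cycles. *)
Definition acyclic G : Prop :=
  forall s : seq V, ucycle (adj G) s -> (size s < 3)%N.

Definition is_tree G : Prop := connected_graph G /\ acyclic G.

End Graphs.

Definition contains_copy (V W : finType) (G : sgraph V) (H : sgraph W) : Prop :=
  exists f : W -> V,
    injective f /\ forall x y, adj H x y -> adj G (f x) (f y).

(* The probability that G(n,p) takes the value G. It is a probability
   distribution only when 0 <= p <= 1; for p = c / n this holds for all
   n >= c (c >= 0), so limits as n tends to infinity are not affected by
   the other values of n. *)
Definition Gnp_mass (R : realType) (n : nat) (p : R) (G : sgraph 'I_n) : R :=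
  \prod_(e : {set 'I_n} | #|e| == 2%N) (if e \in edges G then p else 1 - p).

Definition Gnp_prob (R : realType) (n : nat) (p : R)
    (A : sgraph 'I_n -> Prop) : R :=
  \sum_(G : sgraph 'I_n | `[< A G >]) Gnp_mass p G.

Definition Gnp_almost_surely (R : realType) (p : nat -> R)
    (A : forall n : nat, sgraph 'I_n -> Prop) : Prop :=
  (fun n : nat => Gnp_prob (p n) (@A n)) @ \oo --> (1 : R).

(* Main.v *)
Require Import Defs.
From HB Require Import structures.
From mathcomp Require Import all_boot all_order all_algebra.
From mathcomp Require Import all_classical all_reals all_analysis.
From mathcomp Require Import zify ring lra.
(* Gives finite sets priority over the homonymous lemmas on classical sets. *)
From mathcomp Require Import fintype finset bigop.

Set Implicit Arguments.
Unset Strict Implicit.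
Unset Printing Implicit Defensive.

Import Order.TTheory GRing.Theory Num.Theory.
Import numFieldNormedType.Exports.

(** The only property of the random graph that matters is that it is joined:
    every two disjoint sets of m and b vertices have an edge between them,
    where m is about eps n / (8 d) and b about eps n / 2.

    Such a graph contains all the trees at once, deterministically.  Discard a
    maximal set D of at most m vertices that has at most d |D| outside
    neighbours.  In the remaining set W, a set X of at most m vertices has more
    than d |X| neighbours (otherwise D :|: X would contradict maximality, or be
    so large that joinedness applies to it), and a set of between m and 2 m
    vertices sees all but at most b + 3 m vertices of the graph, which leaves
    room for d |X| plus the whole tree ([joined_expanding]).  In a graph with this
    two-scale expansion, trees are embedded leaf by leaf, after Friedman and
    Pippenger and in the form due to Haxell ([tree_embedding]).  Every vertex v
    has a capacity, the number of further tree neighbours it may still have to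
    receive, and the invariant is a Hall condition: every X of at most m
    vertices has at least as many unused neighbours as its total capacity.  If
    no choice of the next leaf preserved the invariant, each choice would be
    blocked by a tight set, one for which the condition is an equality.  Tight
    sets are closed under union, by submodularity, so the union of all blocking
    sets is tight, and adding the parent of the leaf to it raises the total
    capacity without adding an unused neighbour: a contradiction
    ([roomy_extend]).

    A union bound over pairs of sets shows that G(n, p) with p = c / n fails to
    be joined with probability at most 'C(n, m) 'C(n, b) (1 - p)^(m b)
    ([Gnp_prob_not_joined]).  The binomials are exp(O(eps n log (2 / eps))),
    while p m b is of order c eps^2 n / d, which is far larger when c is as in
    the theorem; so the failure probability is at most exp(- eps n)
    ([Gnp_universal_tail]). *)

(** * Neighbourhoods *)

Section Neighbourhoods.
Variables (V : finType) (e : rel V).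
Implicit Types W X Y : {set V}.

Definition nbhd (W X : {set V}) : {set V} := [set y in W | [exists x in X, e x y]].

Lemma nbhdP W X y :
  reflect (y \in W /\ exists2 x, x \in X & e x y) (y \in nbhd W X).
Proof.
rewrite inE; apply: (iffP andP) => -[yW H]; split=> //.
  by have [x /andP[xX xy]] := existsP H; exists x.
by have [x xX xy] := H; apply/existsP; exists x; rewrite xX.
Qed.

Lemma nbhdS W X Y : X \subset Y -> nbhd W X \subset nbhd W Y.
Proof.
move=> /subsetP XY; apply/subsetP=> y /nbhdP[yW [x xX xy]].
by apply/nbhdP; split=> //; exists x => //; apply: XY.
Qed.

Lemma nbhdU W X Y : nbhd W (X :|: Y) = nbhd W X :|: nbhd W Y.
Proof.
apply/eqP; rewrite eqEsubset; apply/andP; split; last first.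
  by apply/subUsetP; split; apply: nbhdS; rewrite ?subsetUl ?subsetUr.
apply/subsetP=> y /nbhdP[yW [x /setUP[] xX xy]]; apply/setUP; [left|right];
  by apply/nbhdP; split=> //; exists x.
Qed.

Lemma nbhd0 W : nbhd W set0 = set0.
Proof. by apply/setP=> y; rewrite [RHS]inE; apply/nbhdP => -[_ [x]]; rewrite inE. Qed.

End Neighbourhoods.

(** * Adding a leaf inside an expanding set *)

Section LeafExtension.
Variables (V : finType) (e : rel V) (W : {set V}) (d m M : nat).
Implicit Types X Y : {set V}.

(** Expansion at two scales, relative to [W].  The additive term [M] for the
    larger sets leaves them room even after a whole tree on [M] vertices has
    been removed, so only sets of at most [m] vertices need to be watched while
    the tree grows. *)
Definition expanding : Prop :=
  (forall X, X \subset W -> 0 < #|X| <= m -> d * #|X| + 1 <= #|nbhd e W X|) /\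
  (forall X, X \subset W -> m < #|X| <= 2 * m -> d * #|X| + M <= #|nbhd e W X|).

(** The Hall-type invariant of the embedding: [S] is the set of vertices in use
    and [cap v] bounds the number of tree neighbours that [v], used or not, may
    still have to be given outside [S]. *)
Definition roomy (S : {set V}) (cap : V -> nat) : Prop :=
  forall X, X \subset W -> #|X| <= m ->
    \sum_(x in X) cap x <= #|nbhd e W X :\: S|.

Definition tight (S : {set V}) (cap : V -> nat) (X : {set V}) : Prop :=
  [/\ X \subset W, #|X| <= m & #|nbhd e W X :\: S| <= \sum_(x in X) cap x].

Hypotheses (expW : expanding) (m_gt0 : 0 < m).
Variables (S : {set V}) (cap : V -> nat).
Hypotheses (ltSM : #|S| < M) (le_cap_d : forall v, cap v <= d).
Hypothesis roomyS : roomy S cap.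

(** The invariant holds for free, and strictly, just above the threshold [m];
    hence a tight set cannot grow beyond [m]. *)
Lemma large_roomy X : X \subset W -> m < #|X| <= 2 * m ->
  \sum_(x in X) cap x < #|nbhd e W X :\: S|.
Proof.
move=> XW sX; have := expW.2 X XW sX.
have : #|nbhd e W X| <= #|nbhd e W X :\: S| + #|S|.
  by rewrite -(cardsID S (nbhd e W X)) addnC leq_add2l subset_leq_card ?subsetIr.
have : \sum_(x in X) cap x <= d * #|X|.
  by rewrite mulnC -sum_nat_const leq_sum.
lia.
Qed.

(** The number of unused neighbours is submodular and the total capacity is
    modular.  So the deficits of the union and of the intersection add up to at
    most zero, and that of the intersection is controlled by [roomyS]; the union
    is then small by [large_roomy]. *)
Lemma tightU X Y : tight S cap X -> tight S cap Y -> tight S cap (X :|: Y).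
Proof.
move=> [XW Xm tX] [YW Ym tY].
have XYW : X :|: Y \subset W by rewrite subUset XW.
have rI : \sum_(x in X :&: Y) cap x <= #|nbhd e W (X :&: Y) :\: S|.
  apply: roomyS; first by rewrite subIset ?XW.
  by rewrite (leq_trans _ Xm) // subset_leq_card ?subsetIl.
have sumUI : \sum_(x in X :|: Y) cap x + \sum_(x in X :&: Y) cap x
    = \sum_(x in X) cap x + \sum_(x in Y) cap x.
  rewrite (big_setID Y) /= [X in _ = X + _](big_setID Y) /=.
  have -> : (X :|: Y) :&: Y = Y by apply/setIidPr; rewrite subsetUr.
  have -> : (X :|: Y) :\: Y = X :\: Y by rewrite setDUl setDv setU0.
  lia.
have subm : #|nbhd e W (X :|: Y) :\: S| + #|nbhd e W (X :&: Y) :\: S|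
    <= #|nbhd e W X :\: S| + #|nbhd e W Y :\: S|.
  rewrite nbhdU setDUl -[leqRHS]cardsUI leq_add2l subset_leq_card //.
  by rewrite subsetI !setSD // nbhdS // ?subsetIl ?subsetIr.
have tU : #|nbhd e W (X :|: Y) :\: S| <= \sum_(x in X :|: Y) cap x by lia.
split=> //; rewrite leqNgt; apply/negP => ltm.
have sz : #|X :|: Y| <= 2 * m by rewrite (leq_trans (leq_card_setU X Y)) //; lia.
by have := @large_roomy (X :|: Y) XYW; rewrite ltm sz => /(_ isT); lia.
Qed.

Lemma tight_bigcup (Y : {set V}) (F : V -> {set V}) :
  (forall y, y \in Y -> tight S cap (F y)) -> tight S cap (\bigcup_(y in Y) F y).
Proof.
move=> tF; apply: (big_ind (tight S cap)) => //; last exact: tightU.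
by split; rewrite ?sub0set ?cards0 // nbhd0 set0D cards0.
Qed.

Lemma sum_eq_mem (X : {set V}) s : \sum_(v in X) (v == s : nat) = (s \in X).
Proof.
have [sX|sX] := boolP (s \in X).
  rewrite (bigD1 s) //= eqxx big1 // => i /andP[_ /negPf ->] //.
by rewrite big1 // => i iX; case: eqP iX sX => // -> ->.
Qed.

(** The new vertex [y] becomes a neighbour of [s], which uses one unit of
    capacity at both ends.  Only a tight set that sees [y] and avoids both [s]
    and [y] can then lose the invariant. *)
Lemma roomy_extend s : s \in S -> s \in W -> 0 < cap s ->
  (forall v, v \notin S -> 0 < cap v) ->
  exists y, [/\ y \in W, y \notin S, e s y &
    roomy (y |: S) (fun v => cap v - (v == s) - (v == y))].
Proof.
move=> sS sW caps capS; apply: contrapT => no.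
pose Y := nbhd e W [set s] :\: S.
have bad y : exists X, y \in Y -> [/\ tight S cap X, s \notin X & y \in nbhd e W X].
  have [yY|] := boolP (y \in Y); last by exists set0.
  have [/nbhdP[yW [x /set1P -> sy]] yS] := setDP yY.
  apply: contrapT => noX; apply: no; exists y; split=> // X XW Xm.
  rewrite leqNgt; apply/negP => lt; apply: noX; exists X => _.
  have nsy : s != y by apply: contraNneq yS => <-.
  have E1 : \sum_(x in X) (cap x - (x == s) - (x == y)) + (s \in X) + (y \in X)
      = \sum_(x in X) cap x.
    rewrite -!sum_eq_mem -!big_split /=; apply: eq_bigr => v _.
    have := capS y yS; case: (eqVneq v s) => [->|_]; first by rewrite (negPf nsy); lia.
    by case: (eqVneq v y) => [->|_]; lia.
  have E2 : #|nbhd e W X :\: S| = (y \in nbhd e W X) + #|nbhd e W X :\: (y |: S)|.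
    rewrite (cardsD1 y (_ :\: S)) inE yS /=; congr (_ + #|pred_of_set _|).
    by rewrite setDDl setUC.
  have rX := roomyS XW Xm.
  have [sX yX] : s \in X = false /\ y \in nbhd e W X.
    by move: E1 E2 lt rX; case: (s \in X); case: (y \in X);
       case: (y \in nbhd e W X) => /=; lia.
  rewrite sX yX; split=> //; split=> //.
  by move: E1 E2 lt rX; rewrite sX yX; case: (y \in X); lia.
(* [F y] is a tight set that blocks the candidate [y]. *)
have [F HF] := boolp.choice bad.
pose Z := \bigcup_(y in Y) F y.
have [ZW Zm tZ] : tight S cap Z.
  by apply: tight_bigcup => y yY; have [] := HF y yY.
have sZ : s \notin Z.
  by apply/negP => /bigcupP[y yY sF]; have [_ /negP] := HF y yY.
(* Each unused neighbour y of s is seen by F y, so s brings nothing new to Z. *)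
have sub : nbhd e W (s |: Z) :\: S \subset nbhd e W Z :\: S.
  rewrite nbhdU setDUl subUset subxx andbT; apply/subsetP => y yY.
  have [_ _ yF] := HF y yY.
  have := setDP yY => -[_ yS]; rewrite inE yS /=.
  by apply: subsetP yF; apply: nbhdS; apply: bigcup_sup.
have leZ := subset_leq_card sub.
have sZW : s |: Z \subset W by rewrite subUset sub1set sW.
have szZ : #|s |: Z| = #|Z|.+1 by rewrite cardsU1 sZ.
have sumZ : \sum_(x in s |: Z) cap x = cap s + \sum_(x in Z) cap x by rewrite big_setU1.
(* [s |: Z] has at most m + 1 <= 2 m vertices. *)
have [le|lt] := leqP #|s |: Z| m.
  by have := roomyS sZW le; lia.
by have := @large_roomy _ sZW; rewrite lt; lia.
Qed.

End LeafExtension.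

(** * Embedding a tree leaf by leaf *)

Section TreeGrowth.
Variables (U : finType) (T : sgraph U).

Lemma adj_sym : symmetric (adj T).
Proof. by move=> x y; rewrite /adj setUC. Qed.

Lemma adj_irr x : adj T x x = false.
Proof.
apply/negP => xx; have /forall_inP/(_ _ xx) := edges_card2 T.
by rewrite setUid cards1.
Qed.

Definition induced (Q : {set U}) : rel U :=
  [rel x y | [&& adj T x y, x \in Q & y \in Q]].

Definition connected_in (Q : {set U}) : Prop :=
  {in Q &, forall x y, connect (induced Q) x y}.

(** A path inside [Q] between two neighbours of [t] would close a cycle through
    [t].  Hence growing a connected set in a tree always attaches a leaf. *)
Lemma acyclic_one_nbr (Q : {set U}) t q q' : acyclic T -> connected_in Q ->
  t \notin Q -> q \in Q -> q' \in Q -> adj T q t -> adj T q' t -> q' = q.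
Proof.
move=> acT conQ tQ qQ q'Q qt q't; apply/eqP; apply: contraT => neq.
have /connectP[p0 p0P p0l] := conQ _ _ qQ q'Q.
move: p0l; case/shortenP: p0P => p pP pU _ pl {p0}.
have pQ : {subset q :: p <= Q}.
  move=> z; rewrite inE => /predU1P[->//|zp].
  by move: pP zp {pU pl}; elim: p q {qQ qt neq} => //= a p IH q /andP[/and3P[_ _ aQ] pP];
     rewrite inE => /predU1P[->//|]; apply: IH pP.
suff /acT : ucycle (adj T) [:: t, q & p].
  by case: p pl {pP pU pQ} => //= E; rewrite E eqxx in neq.
rewrite /ucycle /= rcons_path -pl q't (adj_sym t) qt /= andbT.
apply/andP; split.
  by apply: sub_path pP => x y /and3P[].
by move: pU => /= ->; rewrite andbT; apply: contra tQ => /pQ.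
Qed.

Lemma connected_in_grow (Q : {set U}) t q : connected_in Q -> q \in Q ->
  adj T q t -> connected_in (t |: Q).
Proof.
move=> conQ qQ qt.
have sub x y : connect (induced Q) x y -> connect (induced (t |: Q)) x y.
  apply: connect_sub => a b /and3P[ab aQ bQ]; apply: connect1.
  by rewrite /induced /= ab !inE aQ bQ !orbT.
have csym : connect_sym (induced (t |: Q)).
  apply: sym_connect_sym => x y; rewrite /induced /= adj_sym.
  by rewrite [(x \in _) && _]andbC.
have tq z : z \in t |: Q -> connect (induced (t |: Q)) q z.
  case/setU1P => [->|zQ]; last by apply/sub/conQ.
  by apply: connect1; rewrite /induced /= qt !inE eqxx qQ orbT.
by move=> x y xQ yQ; apply: connect_trans (tq _ yQ); rewrite csym tq.
Qed.

Lemma connected_boundary (Q : {set U}) : connected_graph T -> Q != set0 ->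
  Q != setT -> exists q t, [/\ q \in Q, t \notin Q & adj T q t].
Proof.
move=> [_ conT] /set0Pn[a aQ]; rewrite -subTset => /subsetPn[b _ bQ].
have /connectP[p pP pl] := conT a b.
move: a aQ pP pl; elim: p => [|c p IH] a aQ /=; first by move=> _ E; rewrite E aQ in bQ.
move=> /andP[ac pP] pl; have [cQ|cQ] := boolP (c \in Q); first exact: IH cQ pP pl.
by exists a, c.
Qed.

(** Haxell's variant of the Friedman-Pippenger theorem.  The embedding is built
    on a growing connected set [Q] of tree vertices; the capacity of an embedded
    vertex is kept at least [d] minus its degree inside [Q], so it is positive
    for every vertex that still misses a neighbour. *)
Lemma tree_embedding (V : finType) (e : rel V) (W : {set V}) (d m M : nat) :
  symmetric e -> expanding e W d m M -> 0 < m -> W != set0 ->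
  is_tree T -> max_degree_le T d -> #|U| <= M ->
  exists f : U -> V, injective f /\ forall x y, adj T x y -> e (f x) (f y).
Proof.
move=> e_sym expW m_gt0 /set0Pn[w0 w0W] [conT acT] degT leUM.
have [u0 _] : exists u0 : U, u0 \in U by apply/card_gt0P; exact: conT.1.
pose degQ (Q : {set U}) q := #|[set y in Q | adj T q y]|.
pose inv (Q : {set U}) f cap := 
  [/\ connected_in Q, {in Q &, injective f}, f @: Q \subset W,
      {in Q &, forall x y, adj T x y -> e (f x) (f y)} &
      [/\ roomy e W m (f @: Q) cap, forall v, cap v <= d,
          forall v, v \notin f @: Q -> cap v = d &
          forall q, q \in Q -> d <= cap (f q) + degQ Q q]].
have grow k : 0 < k <= #|U| -> exists (Q : {set U}) f cap, #|Q| = k /\ inv Q f cap.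
  elim: k => // -[_ _|k IH /andP[_ lekU]].
    (* The extra 1 in the expansion of small sets pays for the first vertex. *)
    exists [set u0], (fun=> w0), (fun=> d); rewrite cards1; split=> //; split.
    - by move=> x y /set1P-> /set1P->; exact: connect0.
    - by move=> x y /set1P-> /set1P->.
    - by apply/subsetP => _ /imsetP[x _ ->].
    - by move=> x y /set1P-> /set1P->; rewrite adj_irr.
    split=> // [X XW Xm|q _]; last exact: leq_addr.
    have [->|X0] := eqVneq X set0; first by rewrite big_set0.
    rewrite imset_set1 sum_nat_const mulnC.
    have : d * #|X| + 1 <= #|nbhd e W X| by apply: expW.1; rewrite // card_gt0 X0.
    by rewrite (cardsD1 w0 (nbhd e W X)); case: (w0 \in _); lia.
  have [|Q [f [cap [szQ [conQ injf fW homf [room capd capS capQ]]]]]] := IH.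
    by rewrite /= ltnW.
  have Q0 : Q != set0 by rewrite -card_gt0 szQ.
  have QT : Q != setT by apply: contraTneq lekU => E; rewrite -leqNgt -szQ E cardsT.
  have [q [t [qQ tQ qt]]] := connected_boundary conT Q0 QT.
  have one z : z \in Q -> adj T z t -> z = q.
    by move=> zQ zt; apply: acyclic_one_nbr conQ tQ qQ zQ qt zt.
  have degq : degQ Q q < d.
    apply: leq_trans (degT q); rewrite /degQ /degree.
    apply: proper_card; apply/properP; split.
      by apply/subsetP => z; rewrite !inE => /andP[].
    by exists t; rewrite !inE // (negPf tQ).
  have szS : #|f @: Q| < M by rewrite card_in_imset // szQ (leq_trans lekU).
  have fqS : f q \in f @: Q by apply: imset_f.
  have capq : 0 < cap (f q) by have := capQ _ qQ; lia.
  have capS0 v : v \notin f @: Q -> 0 < cap v by move/capS->; lia.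
  have [y [yW yS sy room']] := 
    roomy_extend expW m_gt0 szS capd room fqS (subsetP fW _ fqS) capq capS0.
  pose f' z := if z == t then y else f z.
  have f'Q z : z \in Q -> f' z = f z.
    by rewrite /f'; case: eqP => // -> tQ'; rewrite tQ' in tQ.
  have f't : f' t = y by rewrite /f' eqxx.
  have imf' : f' @: (t |: Q) = y |: f @: Q.
    by rewrite imsetU1 f't; congr (_ |: _); apply: eq_in_imset.
  have yf z : z \in Q -> (f z == y) = false.
    by move=> zQ; apply: contraNF yS => /eqP <-; apply: imset_f.
  exists (t |: Q), f', (fun v => cap v - (v == f q) - (v == y)).
  rewrite cardsU1 tQ szQ; split=> //; split.
  - exact: connected_in_grow conQ qQ qt.
  - move=> a b /setU1P[->|aQ] /setU1P[->|bQ] //; rewrite ?f't ?f'Q //.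
    + by move/esym/eqP; rewrite yf.
    + by move/eqP; rewrite yf.
    + exact: injf.
  - by rewrite imf' subUset sub1set yW.
  - move=> a b /setU1P[->|aQ] /setU1P[->|bQ]; rewrite ?adj_irr // ?f't ?f'Q //.
    + by rewrite adj_sym => /(one _ bQ) ->; rewrite e_sym.
    + by move=> /(one _ aQ) ->.
    + exact: homf.
  rewrite imf'; split=> //.
  - by move=> v; rewrite -subnDA (leq_trans (leq_subr _ _)).
  - move=> v; rewrite !inE negb_or => /andP[/negPf -> vS]; rewrite capS //.
    by case: eqP => [E|_]; [rewrite E fqS in vS | rewrite !subn0].
  - move=> z /setU1P[->|zQ].
      rewrite f't eqxx capS //; have -> : (y == f q) = false by rewrite eq_sym yf.
      have : 0 < degQ (t |: Q) t.
        by apply/card_gt0P; exists q; rewrite !inE qQ orbT adj_sym.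
      by lia.
    rewrite f'Q // yf // subn0 (inj_in_eq injf) //.
    have := capQ z zQ; have : degQ Q z + (z == q) <= degQ (t |: Q) z.
      rewrite /degQ; have [->|_] := eqVneq z q; last first.
        rewrite addn0; apply/subset_leq_card/subsetP => x.
        by rewrite !inE => /andP[-> ->]; rewrite orbT.
      rewrite [leqRHS](cardsD1 t) !inE eqxx qt addnC leq_add2l.
      apply/subset_leq_card/subsetP => x; rewrite !inE => /andP[xQ ->].
      by rewrite xQ orbT !andbT; apply: contraNneq tQ => <-.
    by have := capd (f z); case: eqP => /= _; lia.
have [|Q [f [cap [szQ [_ injf _ homf _]]]]] := grow #|U|.
  by rewrite leqnn andbT; exact: conT.1.
have QT : Q = setT by apply/eqP; rewrite eqEcard subsetT cardsT szQ leqnn.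
by exists f; split=> [x y|x y]; [apply: injf|apply: homf]; rewrite QT inE.
Qed.

End TreeGrowth.

(** * Joined graphs contain all bounded degree trees *)

Section Joined.
Variables (V : finType) (e : rel V).
Implicit Types W X Y : {set V}.

Definition joined (m b : nat) : Prop := forall A B : {set V},
  [disjoint A & B] -> #|A| = m -> #|B| = b -> exists x y, [/\ x \in A, y \in B & e x y].

Lemma card_subset_eq (A : {set V}) k : k <= #|A| ->
  exists2 B : {set V}, B \subset A & #|B| = k.
Proof.
move=> kA; have : 0 < 'C(#|A|, k) by rewrite bin_gt0.
rewrite -cards_draws => /card_gt0P[B]; rewrite inE => /andP[BA /eqP Bk].
by exists B.
Qed.

(** Vertices outside [X] and its neighbourhood have no edge from [X], so there
    are fewer than [b] of them. *)
Lemma joined_nbhd m b (X : {set V}) : joined m b -> m <= #|X| ->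
  #|V| < #|nbhd e setT X :|: X| + b.
Proof.
move=> jo mX; rewrite -(cardsC (nbhd e setT X :|: X)) ltn_add2l ltnNge.
apply/negP => bX.
have [A AX Am] := card_subset_eq mX; have [B BX Bb] := card_subset_eq bX.
have [|x [y [xA yB xy]]] := jo A B _ Am Bb.
  rewrite disjoint_subset; apply/subsetP => x xA; rewrite inE.
  by apply/negP => /(subsetP BX); rewrite !inE (subsetP AX _ xA) orbT.
have := subsetP BX _ yB; rewrite inE => /negP; apply; apply/setUP; left.
by apply/nbhdP; split; rewrite ?inE //; exists x => //; apply: (subsetP AX).
Qed.

Lemma nbhdIT (W X : {set V}) : nbhd e W X = nbhd e setT X :&: W.
Proof. by apply/setP => y; rewrite !inE andbC. Qed.

(** [W] is the complement of a maximal badly expanding set [D].  The union of [D]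
    with a badly expanding subset of [W] would expand badly too; by maximality it
    would have more than [m] vertices, but then [joined_nbhd] makes its
    neighbourhood too large. *)
Lemma joined_expanding (d m b M : nat) : joined m b -> 0 < m ->
  M + b + (2 * d + 3) * m <= #|V| ->
  exists2 W : {set V}, W != set0 & expanding e W d m M.
Proof.
move=> jo m_gt0 big.
pose P (D : {set V}) := (#|D| <= m) && (#|nbhd e setT D :\: D| <= d * #|D|).
have P0 : P set0 by rewrite /P nbhd0 set0D cards0.
have [D /maxsetP[/andP[Dm DP] Dmax] _] := maxset_exists P0.
have NX (X : {set V}) : #|nbhd e setT X :|: X| <= #|nbhd e setT X :\: X| + #|X|.
  apply: leq_trans (leq_card_setU _ _); apply/subset_leq_card/subsetP => y.
  by rewrite !inE; case: (y \in X).
exists (~: D).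
  by rewrite -card_gt0; have := cardsC D; nia.
split=> X XD /andP[X1 X2].
  rewrite addn1 ltnNge; apply/negP => small.
  have dis : D :&: X = set0 by apply/eqP; rewrite setI_eq0 disjoint_sym disjoints_subset.
  have szU : #|D :|: X| = #|D| + #|X| by rewrite cardsU dis cards0 subn0.
  have exU : #|nbhd e setT (D :|: X) :\: (D :|: X)| <= d * #|D :|: X|.
    rewrite szU mulnDr; apply: leq_trans (leq_add DP small).
    apply: leq_trans (leq_card_setU _ _); apply: subset_leq_card.
    rewrite [nbhd e (~: D) X]nbhdIT nbhdU setDUl -setDE -!setDDl.
    by apply: setUSS; exact: subsetDl.
  have [leU|ltU] := leqP #|D :|: X| m.
    have := Dmax (D :|: X); rewrite /P leU exU => /(_ isT (subsetUl _ _)) E.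
    by move: szU; rewrite E; lia.
  have := joined_nbhd jo (ltnW ltU); have := NX (D :|: X); nia.
have := joined_nbhd jo (ltnW X1); have := (leq_card_setU (nbhd e setT X) X).1.
have : #|nbhd e setT X| <= #|nbhd e (~: D) X| + #|D|.
  rewrite [nbhd e (~: D) X]nbhdIT -setDE -[leqLHS](cardsID D) addnC leq_add2l.
  exact/subset_leq_card/subsetIr.
have : d * #|X| <= d * (2 * m) by rewrite leq_mul2l X2 orbT.
lia.
Qed.

End Joined.

Lemma joined_universal (V U : finType) (G : sgraph V) (T : sgraph U) (d m b : nat) :
  joined (adj G) m b -> 0 < m -> #|U| + b + (2 * d + 3) * m <= #|V| ->
  is_tree T -> max_degree_le T d -> contains_copy G T.
Proof.
move=> jo m_gt0 big treeT degT.
have [W W0 expW] := joined_expanding jo m_gt0 big.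
exact: tree_embedding (@adj_sym _ G) expW m_gt0 W0 treeT degT (leqnn _).
Qed.

(** * Probabilities in G(n, p) *)

Local Open Scope ring_scope.

(** Graphs on [V] are the sets of pairs, so this is the expansion of a product of
    sums; it evaluates the probability of any event that prescribes each pair
    independently. *)
Lemma sum_sgraph_prod (R : comRingType) (V : finType) (F H : {set V} -> R) :
  \sum_(G : sgraph V) \prod_(e : {set V} | #|e| == 2%N)
     (if e \in edges G then F e else H e)
  = \prod_(e : {set V} | #|e| == 2%N) (F e + H e).
Proof.
(* [F'] and [H'] extend the factors so that only sets of pairs contribute. *)
pose F' (e : {set V}) := if #|e| == 2%N then F e else 0.
pose H' (e : {set V}) := if #|e| == 2%N then H e else 1.
transitivity (\prod_e (F' e + H' e)); last first.
  rewrite [RHS]big_mkcond; apply: eq_bigr => e _.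
  by rewrite /F' /H'; case: ifP => // _; rewrite add0r.
rewrite bigA_distr (bigID (fun J : {set {set V}} => [forall e in J, #|e| == 2%N])) /=.
rewrite [X in _ = _ + X]big1 ?addr0 => [|J /forall_inPn[e eJ ne]]; last first.
  by rewrite (bigD1 e) //= eJ /F' (negPf ne) mul0r.
rewrite (reindex_omap (@edges V) insub) /=; last first.
  by move=> J JP; rewrite insubT.
apply: eq_big => [G|G _]; first by rewrite (edges_card2 G) valK eqxx.
rewrite big_mkcond; apply: eq_bigr => e _; rewrite /F' /H'.
by case: ifP => //; case: ifP => // eG; rewrite (forall_inP (edges_card2 G) _ eG).
Qed.

Section GnpEstimates.
Variables (R : realType) (n : nat) (p : R).

Lemma Gnp_prob_split (A : sgraph 'I_n -> Prop) :
  Gnp_prob p A + Gnp_prob p (fun G => ~ A G) = 1.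
Proof.
transitivity (\sum_(G : sgraph 'I_n) Gnp_mass p G).
  rewrite [RHS](bigID (fun G => `[< A G >])) /=; congr (_ + _).
  by apply: eq_bigl => G; rewrite asbool_neg.
rewrite (sum_sgraph_prod (fun=> p) (fun=> 1 - p)) big1 // => e _.
by rewrite addrC subrK.
Qed.

Lemma Gnp_prob_disjoint (K : {set {set 'I_n}}) :
  (forall e, e \in K -> #|e| = 2%N) ->
  Gnp_prob p (fun G => [disjoint K & edges G]) = (1 - p) ^+ #|K|.
Proof.
move=> K2.
transitivity (\prod_(e : {set 'I_n} | #|e| == 2%N)
                 ((if e \in K then 0 else p) + (1 - p))).
  rewrite -sum_sgraph_prod /Gnp_prob big_mkcond; apply: eq_bigr => G _.
  case: asboolP => [dis|/negP].
    apply: eq_bigr => e _; case: ifP => // eG; case: ifP => // eK.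
    by rewrite (disjointFr dis eK) in eG.
  rewrite -setI_eq0 => /set0Pn[e /setIP[eK eG]].
  by rewrite (bigD1 e) /= ?K2 // eG eK mul0r.
rewrite (bigID (mem K)) /= [X in _ * X]big1 => [|e /andP[_ /negPf ->]]; last first.
  by rewrite addrC subrK.
rewrite mulr1 -prodr_const; apply: eq_big => [e|e /andP[_ ->]]; last by rewrite add0r.
by rewrite andb_idl // => /K2/eqP.
Qed.

Hypotheses (p_ge0 : 0 <= p) (p_le1 : p <= 1).

Lemma Gnp_mass_ge0 (G : sgraph 'I_n) : 0 <= Gnp_mass p G.
Proof. by apply: prodr_ge0 => e _; case: ifP => // _; rewrite subr_ge0. Qed.

Lemma Gnp_prob_ge0 (A : sgraph 'I_n -> Prop) : 0 <= Gnp_prob p A.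
Proof. by apply: sumr_ge0 => G _; apply: Gnp_mass_ge0. Qed.

Lemma Gnp_prob_le1 (A : sgraph 'I_n -> Prop) : Gnp_prob p A <= 1.
Proof. by rewrite -(Gnp_prob_split A) lerDl Gnp_prob_ge0. Qed.

Lemma Gnp_prob_union (I : finType) (P : pred I) (A : sgraph 'I_n -> Prop)
    (B : I -> sgraph 'I_n -> Prop) :
  (forall G, A G -> exists2 i, P i & B i G) ->
  Gnp_prob p A <= \sum_(i | P i) Gnp_prob p (B i).
Proof.
move=> AB; rewrite /Gnp_prob.
under [X in _ <= X]eq_bigr => i _ do rewrite big_mkcond /=.
rewrite exchange_big big_mkcond /=; apply: ler_sum => G _.
have ge0 i : 0 <= (if `[< B i G >] then Gnp_mass p G else 0).
  by case: ifP => // _; apply: Gnp_mass_ge0.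
case: asboolP => [/AB[i Pi /asboolP Bi]|_]; last exact: sumr_ge0.
by rewrite (bigD1 i Pi) /= Bi lerDl sumr_ge0.
Qed.

Lemma Gnp_prob_mono (A B : sgraph 'I_n -> Prop) :
  (forall G, A G -> B G) -> Gnp_prob p A <= Gnp_prob p B.
Proof.
move=> AB; have := @Gnp_prob_union unit predT A (fun=> B).
rewrite big_const card_unit /= addr0; apply=> G /AB; by exists tt.
Qed.

(** Union bound over the pairs of disjoint sets; between two such sets there are
    exactly [m * b] potential edges, all of which must be missing. *)
Lemma Gnp_prob_not_joined (m b : nat) :
  Gnp_prob p (fun G : sgraph 'I_n => ~ joined (adj G) m b)
    <= 'C(n, m)%:R * 'C(n, b)%:R * (1 - p) ^+ (m * b).
Proof.
pose pairs : {set {set 'I_n} * {set 'I_n}} :=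
  setX [set A : {set 'I_n} | #|A| == m] [set B : {set 'I_n} | #|B| == b].
pose cross (AB : {set 'I_n} * {set 'I_n}) : {set {set 'I_n}} :=
  [set [set x; y] | x in AB.1, y in AB.2].
pose P AB := (AB \in pairs) && [disjoint AB.1 & AB.2].
have pairsE AB : P AB ->
    [/\ #|AB.1| = m, #|AB.2| = b & forall x y, x \in AB.1 -> y \in AB.2 -> x != y].
  case: AB => A B /=; rewrite /P !inE /= => /andP[/andP[/eqP Am /eqP Bb] dis].
  by split=> // x y xA yB; apply: contraTneq yB => <-; rewrite (disjointFr dis).
apply: (@le_trans _ _ (\sum_(AB | P AB)
    Gnp_prob p (fun G : sgraph 'I_n => [disjoint cross AB & edges G]))).
  apply: Gnp_prob_union => G; apply: contra_notP => noAB A B dis Am Bb.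
  apply: contrapT => noxy; apply: noAB; exists (A, B).
    by rewrite /P !inE Am Bb !eqxx.
  rewrite -setI_eq0; apply: contraT => /set0Pn[_ /setIP[/imset2P[x y xA yB ->] xyG]].
  by case: noxy; exists x, y.
apply: (@le_trans _ _ (\sum_(AB | P AB) (1 - p) ^+ (m * b))).
  apply: ler_sum => AB /pairsE[Am Bb nxy].
  rewrite Gnp_prob_disjoint.
    suff -> : #|cross AB| = (m * b)%N by [].
    rewrite /cross curry_imset2X card_in_imset ?cardsX ?Am ?Bb //.
    move=> [x y] [x' y'] /setXP[/= xA yB] /setXP[/= x'A y'B] E.
    have : x \in [set x'; y'] by rewrite -E set21.
    have : y \in [set x'; y'] by rewrite -E set22.
    rewrite !inE (negPf (nxy _ _ xA y'B)) orbF eq_sym (negPf (nxy _ _ x'A yB)) /=.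
    by move=> /eqP-> /eqP->.
  by move=> _ /imset2P[x y xA yB ->]; rewrite cards2 nxy.
have q0 : 0 <= (1 - p) ^+ (m * b) by rewrite exprn_ge0 // subr_ge0.
apply: (@le_trans _ _ (\sum_(AB in pairs) (1 - p) ^+ (m * b))).
  rewrite big_mkcondr /=; apply: ler_sum => AB _; by case: ifP.
by rewrite sumr_const cardsX !card_draws card_ord -natrM mulr_natl.
Qed.

End GnpEstimates.

(** * Numerical estimates *)

Section Numerics.
Variable R : realType.
Implicit Types (x eps c : R).

(** The term of index [k] of [(1 + x) ^+ n <= expR (n x)] gives
    ['C(n, k) <= expR (n x) * x ^- k]; then [k <= x n] bounds the last factor. *)
Lemma bin_le_expR (n k : nat) x : 0 < x -> x <= 1 -> k%:R <= x * n%:R ->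
  'C(n, k)%:R <= expR (x * n%:R * (1 - ln x)).
Proof.
move=> x0 x1 kxn.
have lnx : ln x <= 0 by rewrite -ln1 ler_ln ?posrE.
have [nk|kn] := ltnP n k; first by rewrite bin_small // expR_ge0.
have Cx : 'C(n, k)%:R * x ^+ k <= expR (x * n%:R).
  rewrite [x * _]mulrC expRM_natl; apply: (@le_trans _ _ ((1 + x) ^+ n)); last first.
    by rewrite lerXn2r ?nnegrE ?expR_ge0 ?addr_ge0 ?ler01 ?(ltW x0) // expR_ge1Dx.
  rewrite [1 + x]addrC exprD1n (bigD1 (Ordinal (kn : (k < n.+1)%N))) //=.
  rewrite mulr_natl lerDl sumr_ge0 // => i _.
  by rewrite mulrn_wge0 // exprn_ge0 // ltW.
have xk : x ^+ k = expR (k%:R * ln x) by rewrite expRM_natl lnK.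
rewrite mulrDr mulr1 expRD mulrN.
have : 'C(n, k)%:R <= expR (x * n%:R) * expR (- (k%:R * ln x)).
  by rewrite expRN -xk ler_pdivlMr // exprn_gt0.
move/le_trans; apply; rewrite ler_wpM2l ?expR_ge0 // ler_expR lerN2.
by rewrite ler_wnM2r.
Qed.

Lemma onem_expn_le p k : 0 <= p -> p <= 1 -> (1 - p) ^+ k <= expR (- (p * k%:R)) :> R.
Proof.
move=> p0 p1; rewrite -mulNr mulrC expRM_natl lerXn2r ?nnegrE ?expR_ge0 ?subr_ge0 //.
exact: expR_ge1Dx.
Qed.

Lemma ln_ge_half x : 2 <= x -> 1 / 2 <= ln x.
Proof.
move=> x2; have x0 : 0 < x by lra.
have xV0 : 0 < x^-1 by rewrite invr_gt0.
have xV2 : x^-1 <= 1 / 2 by rewrite -[x^-1]div1r ler_pdivrMr //; lra.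
have := @le_ln1Dx R (x^-1 - 1); rewrite addrCA subrr addr0 lnV ?posrE // => H.
have /H : -1 < x^-1 - 1 by lra.
lra.
Qed.

Lemma truncn_ge_half x : 1 <= x -> x / 2 <= (Num.truncn x)%:R.
Proof.
move=> x1; have x0 : 0 <= x by lra.
have /andP[_] := truncn_itv x0; rewrite -natr1.
have : (1 <= Num.truncn x)%N by rewrite truncn_ge_nat.
by rewrite -(ler_nat R) => *; lra.
Qed.

End Numerics.

(** * Almost sure universality *)

Definition tree_universal (n d k : nat) (G : sgraph 'I_n) : Prop :=
  forall T : sgraph 'I_k, is_tree T -> max_degree_le T d -> contains_copy G T.

(** The sets of [joined] have [m = eps n / (8 d)] and [b = eps n / 2] vertices, up
    to rounding: then [b + (2 d + 3) m <= eps n], as [joined_universal] requires.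
    Here [8 d / eps <= n] makes [m] positive and [c <= n] makes [c / n] a
    probability. *)
Lemma Gnp_universal_tail (R : realType) (d n : nat) (eps c : R) :
  (2 <= d)%N -> 0 < eps -> eps < 1 / 2 ->
  10 ^+ 6 * d%:R ^+ 3 * ln d%:R * ln (2 / eps) ^+ 2 / eps <= c ->
  8 * d%:R / eps <= n%:R -> c <= n%:R ->
  `|1 - Gnp_prob (c / n%:R) (@tree_universal n d (Num.truncn ((1 - eps) * n%:R)))|
    <= expR (- (eps * n%:R)).
Proof.
move=> hd e0 e1 hc n_d n_c.
set L := ln (2 / eps) in hc.
have d2 : (2 : R) <= d%:R by rewrite ler_nat.
have lnd : 1 / 2 <= ln (d%:R : R) := ln_ge_half d2.
have L1 : 1 <= L.
  rewrite /L lnM ?posrE ?invr_gt0 //.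
  have : 1 / 2 <= ln (2 : R) by apply: ln_ge_half.
  have : 1 / 2 <= ln eps^-1.
    by apply: ln_ge_half; rewrite -[_^-1]div1r ler_pdivlMr //; lra.
  lra.
have lneps : - ln eps <= L.
  rewrite /L lnM ?posrE ?invr_gt0 // lnV ?posrE //.
  have : 1 / 2 <= ln (2 : R) by apply: ln_ge_half.
  lra.
have n0 : 0 < (n%:R : R).
  apply: lt_le_trans n_d; apply: divr_gt0 => //.
  lra.
have dn : 8 * d%:R <= eps * n%:R by rewrite [eps * _]mulrC -ler_pdivrMr.
set N := eps * n%:R in dn *.
have N0 : 0 < N by rewrite mulr_gt0.
have H5 : 0 <= d%:R * L by apply: mulr_ge0; lra.
(* From d ^ 3 >= 4 d, ln d >= 1 / 2 and L ^ 2 >= L. *)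
have ceps : 512 * (d%:R * L) <= c * eps.
  move: hc; rewrite ler_pdivrMr //; apply: le_trans.
  have H1 : 4 * d%:R <= (d%:R : R) ^+ 3 by rewrite !exprS expr0; nra.
  have H2 : L <= L ^+ 2 by rewrite expr2; nra.
  have H3 : 4 * d%:R * (1 / 2) <= (d%:R : R) ^+ 3 * ln d%:R by apply: ler_pM; lra.
  have H4 : 4 * d%:R * (1 / 2) * L <= (d%:R : R) ^+ 3 * ln d%:R * L ^+ 2.
    by apply: ler_pM; lra.
  have -> : 10 ^+ 6 * d%:R ^+ 3 * ln d%:R * L ^+ 2
      = 10 ^+ 6 * (d%:R ^+ 3 * ln d%:R * L ^+ 2) :> R by ring.
  have H6 : (256 : R) <= 10 ^+ 6 by rewrite !exprS expr0; lra.
  nra.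
have c0 : 0 <= c.
  by rewrite -(pmulr_lge0 c e0); apply: le_trans ceps; lra.
pose p := c / n%:R; have p0 : 0 <= p by rewrite divr_ge0 // ltW.
have p1 : p <= 1 by rewrite ler_pdivrMr // mul1r.
pose m := Num.truncn (N / (8 * d%:R)); pose b := Num.truncn (N / 2).
have d0 : 0 < 8 * (d%:R : R) by lra.
have m1 : 1 <= N / (8 * d%:R) by rewrite ler_pdivlMr // mul1r.
have b1 : 1 <= N / 2 by lra.
have mle : m%:R <= N / (8 * d%:R) by rewrite truncn_le; lra.
have ble : b%:R <= N / 2 by rewrite truncn_le; lra.
have mge := truncn_ge_half m1; have bge := truncn_ge_half b1.
have m_gt0 : (0 < m)%N by rewrite /m truncn_ge_nat //; lra.
have dm : m%:R * d%:R <= N / 8.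
  have -> : N / 8 = N / (8 * d%:R) * d%:R by field; lra.
  by rewrite ler_wpM2r.
have fit : (Num.truncn ((1 - eps) * n%:R) + b + (2 * d + 3) * m <= n)%N.
  have Mle : (Num.truncn ((1 - eps) * n%:R))%:R <= (1 - eps) * (n%:R : R).
    by rewrite truncn_le mulr_ge0 // ?subr_ge0; lra.
  rewrite -(ler_nat R) !natrD natrM natrD natrM.
  have : (m%:R : R) * 2 <= m%:R * d%:R by rewrite ler_wpM2l.
  move: Mle; rewrite mulrBl mul1r -/N => *; lra.
rewrite ger0_norm ?subr_ge0 ?Gnp_prob_le1 // -/N lerBlDl.
rewrite -[X in X <= _](Gnp_prob_split (c / n%:R)
  (@tree_universal n d (Num.truncn ((1 - eps) * n%:R)))) lerD2l.
apply: (@le_trans _ _ (Gnp_prob p (fun G : sgraph 'I_n => ~ joined (adj G) m b))).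
  apply: Gnp_prob_mono => // G; apply: contra_not => jo T treeT degT.
  by apply: joined_universal jo m_gt0 _ treeT degT; rewrite !card_ord.
apply: le_trans (Gnp_prob_not_joined n p0 p1 m b) _.
have le1 : eps <= 1 by lra.
have Cm : 'C(n, m)%:R <= expR (N * (1 - ln eps)).
  apply: bin_le_expR => //; rewrite -/N; nra.
have Cb : 'C(n, b)%:R <= expR (N * (1 - ln eps)).
  apply: bin_le_expR => //; rewrite -/N; lra.
have q := onem_expn_le (m * b) p0 p1.
apply: (@le_trans _ _ (expR (N * (1 - ln eps)) * expR (N * (1 - ln eps)) *
   expR (- (p * (m * b)%:R)))).
  apply: ler_pM => //; rewrite ?mulr_ge0 ?exprn_ge0 ?subr_ge0 //.
  by apply: ler_pM.
rewrite -!expRD ler_expR natrM.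
have pmb : c * eps * N / (64 * d%:R) <= p * (m%:R * b%:R).
  have -> : c * eps * N / (64 * d%:R) = p * (N / (8 * d%:R) / 2 * (N / 2 / 2)).
    rewrite /p /N; field; apply/andP; split; lra.
  by rewrite ler_wpM2l // ler_pM // !divr_ge0 // ?ltW //; lra.
(* The binomials cost at most 2 N (1 + L) <= 4 L N, so this leaves more than N. *)
have key : 8 * (L * N) <= c * eps * N / (64 * d%:R).
  rewrite ler_pdivlMr; last by lra.
  have -> : 8 * (L * N) * (64 * d%:R) = 512 * (d%:R * L) * N by ring.
  by rewrite ler_wpM2r // ltW.
have LN : N <= L * N by rewrite -[X in X <= _]mul1r ler_wpM2r // ltW.
have eN : N * - ln eps <= L * N by rewrite mulrC ler_wpM2r // ltW.
rewrite mulrDr mulr1; lra.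
Qed.

Theorem theorem1p1 (R : realType) (d : nat) (eps c : R)
  (hd : (2 <= d)%N) (heps0 : 0 < eps) (heps1 : eps < 1 / 2)
  (hc : 10 ^+ 6 * d%:R ^+ 3 * ln d%:R * ln (2 / eps) ^+ 2 / eps <= c) :
  Gnp_almost_surely (fun n : nat => c / n%:R)
    (fun (n : nat) (G : sgraph 'I_n) =>
       forall T : sgraph 'I_(Num.truncn ((1 - eps) * n%:R)),
         is_tree T -> max_degree_le T d -> contains_copy G T).
Proof.
apply/cvgrPdist_le => /= delta delta0; near=> n.
have n_d : 8 * d%:R / eps <= n%:R by near: n; apply: nbhs_infty_ger.
have n_c : c <= n%:R by near: n; apply: nbhs_infty_ger.
have n_delta : (eps * delta)^-1 <= n%:R by near: n; apply: nbhs_infty_ger.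
have tail := Gnp_universal_tail hd heps0 heps1 hc n_d n_c.
apply: le_trans tail _; rewrite expRN invf_ple ?posrE ?expR_gt0 //.
have : delta^-1 <= eps * n%:R by rewrite mulrC -ler_pdivrMr // -invfM mulrC.
have := expR_ge1Dx (eps * n%:R); lra.
Unshelve. all: by end_near.
Qed.
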